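(* Assume: (i) $\mathbf V$ has rank $N_p$, and $\mathbf W$ and all $\mathbf W^{(\gamma)}$, $\gamma\in\{1,\dots,N_f\}$, are symmetric positive definite; (ii) $\mathbf M^{(\kappa)}$ is invertible for all $\kappa\in\{1,\dots,K\}$; (iii) $\mathbf K\mathbf D^{(m)}=\mathbf 0$ for all $m\in\{1,\dots,d\}$ and $\mathbf M+\mathbf K$ is symmetric positive definite. Let $\mathbf L^{(\gamma)}:=(\mathbf M+\mathbf K)^{-1}(\mathbf V^{(\gamma)})^T\mathbf W^{(\gamma)}$, $\mathbf F:=(\mathbf I+\mathbf M^{-1}\mathbf K)^{-1}$ and $\mathbf F^{(\kappa)}:=(\mathbf P\mathbf J^{(\kappa)}\mathbf V)^{-1}\mathbf F(\mathbf P\mathbf J^{(\kappa)}\mathbf V)$. Then the flux reconstruction (FR) method $$\mathbf P\mathbf J^{(\kappa)}\mathbf V\frac{d u^{(h,\kappa,e)}}{dt}+\sum_{m=1}^d\mathbf D^{(m)}\mathbf P f^{(h,\kappa,m,e)}+\sum_{\gamma=1}^{N_f}\mathbf L^{(\gamma)}\Big(f^{( *,\kappa,\gamma,e)}-\sum_{n=1}^d\hat n^{(\gamma)}_n\mathbf V^{(\gamma)}\mathbf P f^{(h,\kappa,n,e)}\Big)=0$$ (for all $\kappa\in\{1,\dots,K\}$, $e\in\{1,\dots,N_{\rm Eq}\}$, $t\in(0,T)$) is equivalent to the filtered strong-form discontinuous Galerkin (DG) method $$\mathbf M^{(\kappa)}(\mathbf F^{(\kappa)})^{-1}\frac{d u^{(h,\kappa,e)}}{dt}+\sum_{m=1}^d\mathbf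 M\mathbf D^{(m)}\mathbf P f^{(h,\kappa,m,e)}+\sum_{\gamma=1}^{N_f}(\mathbf V^{(\gamma)})^T\mathbf W^{(\gamma)}\Big(f^{( *,\kappa,\gamma,e)}-\sum_{n=1}^d\hat n^{(\gamma)}_n\mathbf V^{(\gamma)}\mathbf P f^{(h,\kappa,n,e)}\Big)=0$$ (for all $\kappa,e,t$), i.e. a family of coefficient vectors $u^{(h,\kappa,e)}(t)$ satisfies one system if and only if it satisfies the other.
   Context: Reference element and operators. $\hat\Omega\subset\mathbb{R}^d$ is a polytope with volume $|\hat\Omega|$, flat facets $\hat\Gamma^{(\gamma)}$, $\gamma\in\{1,\dots,N_f\}$, and outward unit normals $\hat n^{(\gamma)}$. $\mathcal{V}$ is the space of real polynomial functions on $\hat\Omega$ spanned by the monomials with exponents in a finite set $\mathcal{N}\supseteq\{\alpha\in\mathbb{N}_0^d:|\alpha|\le p\}$ of $N_p$ multi-indices ($p\in\mathbb{N}_0$); $\mathcal{V}$ is assumed closed under each $\partial/\partial\hat x_m$ and contains the constants. $\{\phi^{(i)}\}_{i=1}^{N_p}$ is an arbitrary basis of $\mathcal{V}$. Volume nodes $\hat x^{(i)}\in\hat\Omega$, $i\in\{1,\dots,N\}$ ($N\ge N_p$), facet nodes $\hat x^{(\gamma,i)}\in\hat\Gamma^{(\gamma)}$, $i\in\{1,\dots,N_\gamma\}$, and matrices $\mathbf W\in\mathbb{R}^{N\times N}$, $\mathbf W^{(\gamma)}\in\mathbb{R}^{N_\gamma\times N_\gamma}$ are given. Set $V_{ij}:=\phi^{(j)}(\hat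 x^{(i)})$, $V^{(\gamma)}_{ij}:=\phi^{(j)}(\hat x^{(\gamma,i)})$, $\mathbf M:=\mathbf V^T\mathbf W\mathbf V$, $\mathbf P:=\mathbf M^{-1}\mathbf V^T\mathbf W$, and define $\mathbf D^{(m)}$ by $\partial\phi^{(j)}/\partial\hat x_m=\sum_iD^{(m)}_{ij}\phi^{(i)}$. For a finite set $\mathcal{M}\subset\mathcal{N}$ and $C:\mathcal{M}\to\mathbb{R}$, $\mathbf K:=\sum_{\alpha\in\mathcal{M}}\frac{C(\alpha)}{|\hat\Omega|}(\mathbf D^{(\alpha)})^T\mathbf M\mathbf D^{(\alpha)}$ with $\mathbf D^{(\alpha)}:=(\mathbf D^{(1)})^{\alpha_1}\cdots(\mathbf D^{(d)})^{\alpha_d}$. Mesh. $\bar\Omega\subset\mathbb{R}^d$ is the union of compact elements $\Omega^{(\kappa)}$, $\kappa\in\{1,\dots,K\}$, with disjoint interiors, each the image of $\hat\Omega$ under a smooth bijective time-independent map $X^{(\kappa)}$ with Jacobian matrix $\boldsymbol{\mathcal J}^{(\kappa)}$ and $\mathcal J^{(\kappa)}:=\det\boldsymbol{\mathcal J}^{(\kappa)}>0$; $\Gamma^{(\kappa,\gamma)}:=X^{(\kappa)}(\hat\Gamma^{(\gamma)})$ has outward unit normal $n^{(\kappa,\gamma)}$, and $\mathcal J^{(\kappa,\gamma)}(\hat x):=\|\mathcal J^{(\kappa)}(\hat x)(\boldsymbol{\mathcal J}^{(\kappa)}(\hat x))^{-T}\hat n^{(\gamma)}\|_2$. $\mathbf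 J^{(\kappa)}:=\mathrm{diag}(\mathcal J^{(\kappa)}(\hat x^{(1)}),\dots,\mathcal J^{(\kappa)}(\hat x^{(N)}))$ and $\mathbf M^{(\kappa)}:=\mathbf V^T\mathbf W\mathbf J^{(\kappa)}\mathbf V$. Semi-discrete quantities. The conservation law is $\partial_tU+\sum_{m=1}^d\partial_{x_m}F^{(m)}(U)=0$ with $U\in\Upsilon\subseteq\mathbb{R}^{N_{\rm Eq}}$ and $F^{(m)}:\Upsilon\to\mathbb{R}^{N_{\rm Eq}}$. Unknown (differentiable in $t$) vectors $u^{(h,\kappa,e)}(t)\in\mathbb{R}^{N_p}$ define $U^{(h,\kappa)}_e(\hat x,t)=\sum_iu^{(h,\kappa,e)}_i(t)\phi^{(i)}(\hat x)$, assumed to take values in $\Upsilon$. The vector $f^{(h,\kappa,m,e)}(t)\in\mathbb{R}^N$ has entries equal to the $e$-th component of $\sum_{n=1}^d\mathcal J^{(\kappa)}[(\boldsymbol{\mathcal J}^{(\kappa)})^{-1}]_{mn}F^{(n)}(U^{(h,\kappa)})$ at the nodes $\hat x^{(i)}$; the vector $f^{( *,\kappa,\gamma,e)}(t)\in\mathbb{R}^{N_\gamma}$ has entries equal to the $e$-th component of $\mathcal J^{(\kappa,\gamma)}F^*(U^{(h,\kappa)},U^{(+,\kappa,\gamma)},n^{(\kappa,\gamma)}\circ X^{(\kappa)})$ at the nodes $\hat x^{(\gamma,i)}$, where $F^*:\Upsilon\times\Upsilon\times\mathbb{S}^{d-1}\to\mathbb{R}^{N_{\rm Eq}}$ is a consistent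 and conservative numerical flux and $U^{(+,\kappa,\gamma)}$ is external (neighbour or boundary) data. *)

(* Defs.v *)
(* Points and vectors of R^d are rows 'rV[R]_d; coefficient
   and nodal vectors, on which the operators act from the left, are columns. *)
From HB Require Import structures.
From mathcomp Require Import all_boot all_order all_algebra finmap.
From mathcomp Require Import all_classical all_reals all_analysis.

Set Implicit Arguments.
Unset Strict Implicit.
Unset Printing Implicit Defensive.

Import Order.TTheory GRing.Theory Num.Theory numFieldNormedType.Exports.

Local Open Scope classical_set_scope.
Local Open Scope ring_scope.

Definition dotv (R : realType) (d : nat) (u v : 'rV[R]_d) : R :=
  \sum_(i < d) u 0 i * v 0 i.

(* The library norm `|v| on 'rV is the sup norm. *)
Definition norm2 (R : realType) (d : nat) (v : 'rV[R]_d) : R :=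
  Num.sqrt (dotv v v).

Definition spd (R : realType) (n : nat) (A : 'M[R]_n) : Prop :=
  A^T = A /\ forall v : 'cV[R]_n, v != 0 -> 0 < (v^T *m A *m v) 0 0.

Definition box (R : realType) (d : nat) (a b : 'rV[R]_d) : set 'rV[R]_d :=
  [set x | forall i, a 0 i <= x 0 i <= b 0 i].

Definition box_volume (R : realType) (d : nat) (a b : 'rV[R]_d) : R :=
  \prod_(i < d) (b 0 i - a 0 i).

(* d-dimensional Lebesgue outer measure. *)
Definition volume (R : realType) (d : nat) (A : set 'rV[R]_d) : \bar R :=
  ereal_inf [set s | exists a b : nat -> 'rV[R]_d,
    [/\ forall k i, a k 0 i <= b k 0 i,
        A `<=` \bigcup_k box (a k) (b k) &
        s = (\sum_(0 <= k <oo) (box_volume (a k) (b k))%:E)%E]].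

Definition pderiv (R : realType) (d : nat) (V : normedModType R) (m : 'I_d)
    (f : 'rV[R]_d -> V) : 'rV[R]_d -> V :=
  fun x => 'D_(delta_mx 0 m) f x.

(* C^oo on a neighbourhood of A, so that derivatives make sense at boundary
   points of A. *)
Definition smooth_on (R : realType) (d : nat) (V : normedModType R)
    (A : set 'rV[R]_d) (f : 'rV[R]_d -> V) : Prop :=
  exists U : set 'rV[R]_d, [/\ open U, A `<=` U &
    forall (s : seq 'I_d) (x : 'rV[R]_d), U x ->
      differentiable (foldr (@pderiv R d V) f s) x].

(* 'J acts on rows from the right; the transpose has entries dX_i/dx_j. *)
Definition jac (R : realType) (d : nat) (X : 'rV[R]_d -> 'rV[R]_d)
    (x : 'rV[R]_d) : 'M[R]_d := ('J X x)^T.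

(* Points of G around which G fills the hyperplane with normal n. *)
Definition flat_interior (R : realType) (d : nat) (G : set 'rV[R]_d)
    (n : 'rV[R]_d) : set 'rV[R]_d :=
  [set x | G x /\ \forall y \near x, dotv (y - x) n = 0 -> G y].

(* A polytope (not necessarily convex): a connected compact body whose boundary
   is the union of the non-overlapping flat facets G c, where n c is the
   outward unit normal on G c. *)
Record is_polytope (R : realType) (d nf : nat) (Om : set 'rV[R]_d)
    (G : 'I_nf -> set 'rV[R]_d) (n : 'I_nf -> 'rV[R]_d) : Prop := IsPolytope {
  polytope_compact : compact Om;
  polytope_connected : connected Om;
  polytope_nonempty : Om !=set0;
  polytope_regular : closure (interior Om) = Om;
  polytope_boundary : Om `\` interior Om = \bigcup_c G c;
  polytope_facet_nonempty : forall c, G c !=set0;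
  polytope_facet_flat : forall c x y, G c x -> G c y -> dotv (y - x) (n c) = 0;
  polytope_facet_regular : forall c, closure (flat_interior (G c) (n c)) = G c;
  polytope_facet_disjoint : forall c c', c != c' ->
    flat_interior (G c) (n c) `&` G c' = set0;
  polytope_normal_unit : forall c, norm2 (n c) = 1;
  polytope_normal_outward : forall c x, flat_interior (G c) (n c) x ->
    \forall h \near 0^'+, interior Om (x - h *: n c) /\ ~ Om (x + h *: n c)
}.

Record refElement (R : realType) (d : nat) := RefElement {
  re_dom : set 'rV[R]_d;
  re_nf : nat;
  re_facet : 'I_re_nf -> set 'rV[R]_d;
  re_normal : 'I_re_nf -> 'rV[R]_d;
  re_polytope : is_polytope re_dom re_facet re_normal
}.

(* Since the reference element has nonempty interior, a polynomial function on
   it is identified with its unique polynomial extension to R^d. *)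
Definition polyspace (R : realType) (d : nat) (S : {fset {ffun 'I_d -> nat}})
    (f : 'rV[R]_d -> R) : Prop :=
  exists c : {ffun 'I_d -> nat} -> R,
    forall x, f x = \sum_(a <- S) c a * \prod_(i < d) x 0 i ^+ a i.

Record discretization (R : realType) (d : nat) (E : refElement R d) :=
  Discretization {
  ds_p : nat;
  ds_exps : {fset {ffun 'I_d -> nat}};
  ds_exps_total : forall a : {ffun 'I_d -> nat},
    (\sum_(i < d) a i <= ds_p)%N -> a \in ds_exps;
  ds_pderiv_closed : forall (m : 'I_d) (f : 'rV[R]_d -> R),
    polyspace ds_exps f -> polyspace ds_exps (pderiv m f);
  ds_const : forall c : R, polyspace ds_exps (fun=> c);
  ds_np : nat;
  ds_npE : ds_np = #|` ds_exps|;
  ds_phi : 'I_ds_np -> 'rV[R]_d -> R;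
  ds_phi_mem : forall i, polyspace ds_exps (ds_phi i);
  ds_phi_span : forall f, polyspace ds_exps f ->
    exists c : 'I_ds_np -> R, forall x, f x = \sum_i c i * ds_phi i x;
  ds_phi_free : forall c : 'I_ds_np -> R,
    (forall x, \sum_i c i * ds_phi i x = 0) -> forall i, c i = 0;
  ds_n : nat;
  ds_np_le : (ds_np <= ds_n)%N;
  ds_node : 'I_ds_n -> 'rV[R]_d;
  ds_node_mem : forall i, re_dom E (ds_node i);
  ds_nfn : 'I_(re_nf E) -> nat;
  ds_fnode : forall c : 'I_(re_nf E), 'I_(ds_nfn c) -> 'rV[R]_d;
  ds_fnode_mem : forall c i, re_facet c (@ds_fnode c i);
  ds_W : 'M[R]_ds_n;
  ds_Wf : forall c : 'I_(re_nf E), 'M[R]_(ds_nfn c);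
  ds_D : 'I_d -> 'M[R]_ds_np;
  ds_DE : forall m j x, pderiv m (ds_phi j) x = \sum_i ds_D m i j * ds_phi i x
}.

Definition vdm (R : realType) (d : nat) (E : refElement R d)
    (B : discretization E) : 'M[R]_(ds_n B, ds_np B) :=
  \matrix_(i, j) ds_phi j (ds_node i).

Definition vdmf (R : realType) (d : nat) (E : refElement R d)
    (B : discretization E) (c : 'I_(re_nf E)) : 'M[R]_(ds_nfn B c, ds_np B) :=
  \matrix_(i, j) ds_phi j (ds_fnode i).

Definition mass (R : realType) (d : nat) (E : refElement R d)
    (B : discretization E) : 'M[R]_(ds_np B) :=
  (vdm B)^T *m ds_W B *m vdm B.

Definition projmx (R : realType) (d : nat) (E : refElement R d)
    (B : discretization E) : 'M[R]_(ds_np B, ds_n B) :=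
  invmx (mass B) *m (vdm B)^T *m ds_W B.

Definition Dmulti (R : realType) (d : nat) (E : refElement R d)
    (B : discretization E) (a : {ffun 'I_d -> nat}) : 'M[R]_(ds_np B) :=
  \prod_(m < d) ds_D B m ^+ a m.

Definition Kmx (R : realType) (d : nat) (E : refElement R d)
    (B : discretization E) (S : {fset {ffun 'I_d -> nat}})
    (C : {ffun 'I_d -> nat} -> R) : 'M[R]_(ds_np B) :=
  \sum_(a <- S) (C a / fine (volume (re_dom E))) *:
    ((Dmulti B a)^T *m mass B *m Dmulti B a).

(* At y = X x, the outward unit normal is the unit vector orthogonal to the
   images under the Jacobian matrix of the tangent vectors of the reference
   facet, and on the same side as the image of the reference outward normal. *)
Definition is_outward_normal (R : realType) (d : nat) (E : refElement R d)
    (X : 'rV[R]_d -> 'rV[R]_d) (c : 'I_(re_nf E))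
    (n : 'rV[R]_d -> 'rV[R]_d) : Prop :=
  forall x, re_facet c x ->
    [/\ norm2 (n (X x)) = 1,
        forall v, dotv v (re_normal c) = 0 ->
          dotv (v *m (jac X x)^T) (n (X x)) = 0 &
        0 < dotv (re_normal c *m (jac X x)^T) (n (X x))].

Record mesh (R : realType) (d : nat) (E : refElement R d) := Mesh {
  ms_dom : set 'rV[R]_d;
  ms_k : nat;
  ms_elt : 'I_ms_k -> set 'rV[R]_d;
  ms_domE : ms_dom = \bigcup_k ms_elt k;
  ms_elt_compact : forall k, compact (ms_elt k);
  ms_elt_disjoint : forall k k', k != k' ->
    interior (ms_elt k) `&` interior (ms_elt k') = set0;
  ms_X : 'I_ms_k -> 'rV[R]_d -> 'rV[R]_d;
  ms_X_smooth : forall k, smooth_on (re_dom E) (ms_X k);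
  ms_X_bij : forall k, set_bij (re_dom E) (ms_elt k) (ms_X k);
  ms_det_gt0 : forall k x, re_dom E x -> 0 < \det (jac (ms_X k) x);
  ms_normal : 'I_ms_k -> 'I_(re_nf E) -> 'rV[R]_d -> 'rV[R]_d;
  ms_normalP : forall k c, is_outward_normal (ms_X k) c (ms_normal k c)
}.

Definition detJ (R : realType) (d : nat) (E : refElement R d) (M : mesh E)
    (k : 'I_(ms_k M)) (x : 'rV[R]_d) : R := \det (jac (ms_X k) x).

(* n *m A is the row form of A^T n^T. *)
Definition facetJ (R : realType) (d : nat) (E : refElement R d) (M : mesh E)
    (k : 'I_(ms_k M)) (c : 'I_(re_nf E)) (x : 'rV[R]_d) : R :=
  norm2 (detJ k x *: (re_normal c *m invmx (jac (ms_X k) x))).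

Definition Jdiag (R : realType) (d : nat) (E : refElement R d)
    (B : discretization E) (M : mesh E) (k : 'I_(ms_k M)) : 'M[R]_(ds_n B) :=
  diag_mx (\row_i detJ k (ds_node i)).

Definition massk (R : realType) (d : nat) (E : refElement R d)
    (B : discretization E) (M : mesh E) (k : 'I_(ms_k M)) : 'M[R]_(ds_np B) :=
  (vdm B)^T *m ds_W B *m Jdiag B k *m vdm B.

Definition PJV (R : realType) (d : nat) (E : refElement R d)
    (B : discretization E) (M : mesh E) (k : 'I_(ms_k M)) : 'M[R]_(ds_np B) :=
  projmx B *m Jdiag B k *m vdm B.

(* The fluxes are total functions; only their values on admissible states (and
   unit vectors) are constrained or used. *)
Record conservation_law (R : realType) (d : nat) := ConservationLaw {
  cl_neq : nat;
  cl_states : set 'rV[R]_cl_neq;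
  cl_flux : 'I_d -> 'rV[R]_cl_neq -> 'rV[R]_cl_neq
}.

Record numerical_flux (R : realType) (d : nat) (L : conservation_law R d) :=
  NumericalFlux {
  nf_fun : 'rV[R]_(cl_neq L) -> 'rV[R]_(cl_neq L) -> 'rV[R]_d ->
    'rV[R]_(cl_neq L);
  nf_consistent : forall U n, @cl_states R d L U -> norm2 n = 1 ->
    nf_fun U U n = \sum_(m < d) n 0 m *: cl_flux m U;
  nf_conservative : forall U U' n, @cl_states R d L U -> @cl_states R d L U' ->
    norm2 n = 1 -> nf_fun U U' n = - nf_fun U' U (- n)
}.

Definition coef_family (R : realType) (d : nat) (E : refElement R d)
    (B : discretization E) (M : mesh E) (L : conservation_law R d) : Type :=
  'I_(ms_k M) -> 'I_(cl_neq L) -> R -> 'cV[R]_(ds_np B).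

(* External states as functions of (element, facet, reference point, time).
   They may depend on the whole discrete solution, as neighbour data do. *)
Definition external_data (R : realType) (d : nat) (E : refElement R d)
    (B : discretization E) (M : mesh E) (L : conservation_law R d) : Type :=
  coef_family B M L ->
  'I_(ms_k M) -> 'I_(re_nf E) -> 'rV[R]_d -> R -> 'rV[R]_(cl_neq L).

Definition Uh (R : realType) (d : nat) (E : refElement R d)
    (B : discretization E) (M : mesh E) (L : conservation_law R d)
    (u : coef_family B M L) (k : 'I_(ms_k M)) (x : 'rV[R]_d) (t : R) :
    'rV[R]_(cl_neq L) :=
  \row_e \sum_(i < ds_np B) u k e t i 0 * ds_phi i x.

Definition fvol (R : realType) (d : nat) (E : refElement R d)
    (B : discretization E) (M : mesh E) (L : conservation_law R d)
    (u : coef_family B M L) (k : 'I_(ms_k M)) (m : 'I_d) (e : 'I_(cl_neq L))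
    (t : R) : 'cV[R]_(ds_n B) :=
  \col_i (\sum_(n < d)
    (detJ k (ds_node i) * invmx (jac (ms_X k) (ds_node i)) m n) *:
      cl_flux n (Uh u k (ds_node i) t)) 0 e.

Definition fnum (R : realType) (d : nat) (E : refElement R d)
    (B : discretization E) (M : mesh E) (L : conservation_law R d)
    (Fs : numerical_flux L) (Up : external_data B M L)
    (u : coef_family B M L) (k : 'I_(ms_k M)) (c : 'I_(re_nf E))
    (e : 'I_(cl_neq L)) (t : R) : 'cV[R]_(ds_nfn B c) :=
  \col_i (facetJ k c (ds_fnode i) *:
    nf_fun Fs (Uh u k (ds_fnode i) t) (Up u k c (ds_fnode i) t)
      (ms_normal k c (ms_X k (ds_fnode i)))) 0 e.

(* f^(star) - sum_n n_n V^(c) P f^(n), common to both methods. *)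
Definition facet_jump (R : realType) (d : nat) (E : refElement R d)
    (B : discretization E) (M : mesh E) (L : conservation_law R d)
    (Fs : numerical_flux L) (Up : external_data B M L)
    (u : coef_family B M L) (k : 'I_(ms_k M)) (c : 'I_(re_nf E))
    (e : 'I_(cl_neq L)) (t : R) : 'cV[R]_(ds_nfn B c) :=
  fnum Fs Up u k c e t -
  \sum_(n < d) re_normal c 0 n *: (vdmf B c *m projmx B *m fvol u k n e t).

Definition liftFR (R : realType) (d : nat) (E : refElement R d)
    (B : discretization E) (K : 'M[R]_(ds_np B)) (c : 'I_(re_nf E)) :
    'M[R]_(ds_np B, ds_nfn B c) :=
  invmx (mass B + K) *m (vdmf B c)^T *m ds_Wf B c.

Definition filter_ref (R : realType) (d : nat) (E : refElement R d)
    (B : discretization E) (K : 'M[R]_(ds_np B)) : 'M[R]_(ds_np B) :=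
  invmx (1%:M + invmx (mass B) *m K).

Definition filter_elt (R : realType) (d : nat) (E : refElement R d)
    (B : discretization E) (K : 'M[R]_(ds_np B)) (M : mesh E)
    (k : 'I_(ms_k M)) : 'M[R]_(ds_np B) :=
  invmx (PJV B k) *m filter_ref K *m PJV B k.

Definition solves_FR (R : realType) (d : nat) (E : refElement R d)
    (B : discretization E) (K : 'M[R]_(ds_np B)) (M : mesh E)
    (L : conservation_law R d) (Fs : numerical_flux L)
    (Up : external_data B M L) (T : R) (u : coef_family B M L) : Prop :=
  forall (k : 'I_(ms_k M)) (e : 'I_(cl_neq L)) (t : R), 0 < t < T ->
    PJV B k *m derive1 (u k e) t
    + \sum_(m < d) ds_D B m *m projmx B *m fvol u k m e t
    + \sum_(c < re_nf E) liftFR K c *m facet_jump Fs Up u k c e t = 0.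

Definition solves_DG (R : realType) (d : nat) (E : refElement R d)
    (B : discretization E) (K : 'M[R]_(ds_np B)) (M : mesh E)
    (L : conservation_law R d) (Fs : numerical_flux L)
    (Up : external_data B M L) (T : R) (u : coef_family B M L) : Prop :=
  forall (k : 'I_(ms_k M)) (e : 'I_(cl_neq L)) (t : R), 0 < t < T ->
    massk B k *m invmx (filter_elt K k) *m derive1 (u k e) t
    + \sum_(m < d) mass B *m ds_D B m *m projmx B *m fvol u k m e t
    + \sum_(c < re_nf E)
        (vdmf B c)^T *m ds_Wf B c *m facet_jump Fs Up u k c e t = 0.

(* Main.v *)
Require Import Defs.
From HB Require Import structures.
From mathcomp Require Import all_boot all_order all_algebra finmap.
From mathcomp Require Import all_classical all_reals all_analysis.

Set Implicit Arguments.
Unset Strict Implicit.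
Unset Printing Implicit Defensive.

Import Order.TTheory GRing.Theory Num.Theory numFieldNormedType.Exports.

Local Open Scope classical_set_scope.
Local Open Scope ring_scope.

(** Write M for the mass matrix, K for the FR matrix and A = M^-1 M^(kappa) for
    the projected Jacobian.  The DG equation is the FR equation multiplied from
    the left by M + K, term by term.  The filter is
    F = (1 + M^-1 K)^-1 = (M + K)^-1 M, and its conjugate by A satisfies
    M^(kappa) (A^-1 F A)^-1 = M^(kappa) A^-1 F^-1 A = M F^-1 A = (M + K) A
    ([mass_conj_filterV]), which settles the time derivative; K D^(m) = 0 gives
    (M + K) D^(m) = M D^(m); and the factor (M + K)^-1 in the lifting matrices
    cancels.  As M + K is positive definite, hence invertible, the equations
    have the same solutions.  The rank of the Vandermonde matrix enters through
    the invertibility of M ([unitmx_gram]). *)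

(** A row vector v in the left kernel makes the quadratic form vanish at v^T. *)
Lemma unitmx_posdef (R : realType) (n : nat) (A : 'M[R]_n) :
  (forall v : 'cV[R]_n, v != 0 -> 0 < (v^T *m A *m v) 0 0) -> A \in unitmx.
Proof.
move=> A_pos; rewrite -row_free_unit; apply: inj_row_free => v vA0.
apply/eqP/negPn/negP => v_neq0.
have := A_pos v^T; rewrite trmxK vA0 mul0mx mxE ltxx => v_pos.
by have := v_pos _; rewrite -(trmx0 R) (inj_eq trmx_inj) => /(_ v_neq0).
Qed.

(** Full column rank makes V injective, so the quadratic form of V^T W V at v
    is that of W at the nonzero vector V v. *)
Lemma unitmx_gram (R : realType) (m n : nat) (V : 'M[R]_(m, n)) (W : 'M[R]_m) :
  \rank V = n -> spd W -> V^T *m W *m V \in unitmx.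
Proof.
move=> rankV [_ W_pos]; apply: unitmx_posdef => v v_neq0.
have VT_free : row_free V^T by rewrite /row_free mxrank_tr rankV.
have Vv_neq0 : V *m v != 0.
  rewrite -(inj_eq trmx_inj) trmx_mul trmx0 mulmx_free_eq0 //.
  by rewrite -(trmx0 R) (inj_eq trmx_inj).
by have := W_pos _ Vv_neq0; rewrite trmx_mul !mulmxA.
Qed.

Lemma invmx_mul (R : comUnitRingType) (n : nat) (A B : 'M[R]_n) :
  A \in unitmx -> B \in unitmx -> invmx (A *m B) = invmx B *m invmx A.
Proof.
move=> A_unit B_unit; have AB_unit : A *m B \in unitmx.
  by rewrite unitmx_mul A_unit.
apply: (can_inj (mulKmx AB_unit)).
by rewrite mulmxV // -mulmxA mulKVmx // mulmxV.
Qed.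

(** The inverse of 1 + M^-1 K is the reference filter, and N the curvilinear
    mass matrix.  Since N = M A, the outer conjugation by A cancels against N
    and leaves M (1 + M^-1 K) A. *)
Lemma mass_conj_filterV (R : comUnitRingType) (n : nat) (M N K : 'M[R]_n) :
  M \in unitmx -> N \in unitmx -> M + K \in unitmx ->
  let A := invmx M *m N in
  N *m invmx (invmx A *m invmx (1%:M + invmx M *m K) *m A) = (M + K) *m A.
Proof.
move=> M_unit N_unit MK_unit A.
have A_unit : A \in unitmx by rewrite unitmx_mul unitmx_inv M_unit.
have NE : N = M *m A by rewrite mulKVmx.
clearbody A.
have filterV : 1%:M + invmx M *m K = invmx M *m (M + K).
  by rewrite mulmxDr mulVmx.
have filterV_unit : 1%:M + invmx M *m K \in unitmx.
  by rewrite filterV unitmx_mul unitmx_inv M_unit.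
rewrite invmx_mul ?unitmx_mul ?unitmx_inv ?A_unit //.
rewrite invmx_mul ?unitmx_inv // !invmxK filterV.
by rewrite NE !mulmxA mulmxK // mulmxV // mul1mx.
Qed.

Theorem lemma3p4 (R : realType) (d : nat)
  (E : refElement R d) (B : discretization E) (M : mesh E)
  (S : {fset {ffun 'I_d -> nat}}) (C : {ffun 'I_d -> nat} -> R)
  (HS : (S `<=` ds_exps B)%fset)
  (L : conservation_law R d) (Fs : numerical_flux L)
  (Up : external_data B M L) (T : R)
  (* (i) *)
  (HV : \rank (vdm B) = ds_np B)
  (HW : spd (ds_W B))
  (HWf : forall c : 'I_(re_nf E), spd (ds_Wf B c))
  (* (ii) *)
  (HM : forall k : 'I_(ms_k M), massk B k \in unitmx)
  (* (iii) *)
  (HKD : forall m : 'I_d, Kmx B S C *m ds_D B m = 0)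
  (HMK : spd (mass B + Kmx B S C))
  (* the family of coefficient vectors *)
  (u : coef_family B M L)
  (Hdiff : forall (k : 'I_(ms_k M)) (e : 'I_(cl_neq L)) (t : R),
     0 < t < T -> derivable (u k e) t 1)
  (Hstate : forall (k : 'I_(ms_k M)) (x : 'rV[R]_d) (t : R),
     re_dom E x -> 0 < t < T ->
     @cl_states R d L (Uh u k x t))
  (Hext : forall (k : 'I_(ms_k M)) (c : 'I_(re_nf E)) (x : 'rV[R]_d) (t : R),
     re_facet c x -> 0 < t < T ->
     @cl_states R d L (Up u k c x t)) :
  solves_FR (Kmx B S C) Fs Up T u <-> solves_DG (Kmx B S C) Fs Up T u.
Proof.
have M_unit : mass B \in unitmx by exact: unitmx_gram.
have MK_unit : mass B + Kmx B S C \in unitmx.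
  by case: HMK => _; exact: unitmx_posdef.
have PJVE k : PJV B k = invmx (mass B) *m massk B k.
  by rewrite /PJV /projmx /massk !mulmxA.
have DG_FR k e t :
  massk B k *m invmx (filter_elt (Kmx B S C) k) *m derive1 (u k e) t
  + \sum_(m < d) mass B *m ds_D B m *m projmx B *m fvol u k m e t
  + \sum_(c < re_nf E)
      (vdmf B c)^T *m ds_Wf B c *m facet_jump Fs Up u k c e t
  = (mass B + Kmx B S C) *m
    (PJV B k *m derive1 (u k e) t
     + \sum_(m < d) ds_D B m *m projmx B *m fvol u k m e t
     + \sum_(c < re_nf E)
         liftFR (Kmx B S C) c *m facet_jump Fs Up u k c e t).
  rewrite !mulmxDr !mulmx_sumr; congr (_ + _ + _).
  - by rewrite /filter_elt /filter_ref PJVE mass_conj_filterV // mulmxA.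
  - by apply: eq_bigr => m _; rewrite !mulmxA mulmxDl HKD addr0.
  - apply: eq_bigr => c _.
    by rewrite /liftFR !mulmxA mulmxV // mul1mx.
split=> sol k e t t_in; first by rewrite DG_FR sol // mulmx0.
by apply: (can_inj (mulKmx MK_unit)); rewrite -DG_FR sol // mulmx0.
Qed.
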